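(* Let $K$ be a number field with ring of integers $\mathcal{O}_K$, and let $\mathfrak{p}$ be a prime ideal of $\mathcal{O}_K$ dividing $(2)$ with ramification index $e(\mathfrak{p})=4$ and inertial degree $f(\mathfrak{p})=1$. Let $\tau\in\mathcal{O}_K$ be any element of $\mathfrak{p}\setminus\mathfrak{p}^2$. Then $s=s_4(K_{\mathfrak{p}})$ is one of $\{1,2,3,4,5,6\}$. Specifically: (5) If $\mathfrak{p}^5\parallel\tau^4+2$, then - $s=3$ iff $\mathfrak{p}^{13}\mid\tau^{12}+\tau^8+2\tau^6+4\tau^3+4$; - $s=4$ iff $\mathfrak{p}^{13}\mid\tau^8+2\tau^6+4\tau^3+4$; - $s=5$ iff $\mathfrak{p}^{13}\mid\tau^8+4\tau^3+4\tau^2+4$; - $s=6$ iff $\mathfrak{p}^{13}\mid\tau^{12}+\tau^8+4\tau^3+4\tau^2+4$; and one of these holds. (6) If $\mathfrak{p}^6\parallel\tau^4+2$, put $A_1=4\tau^3+4\tau^2+4\tau+(\tau^4+2\tau^2+2)$, $A_2=4\tau+(\tau^4+1)(\tau^4+2\tau^2+2)$, $A_3=4\tau+(\tau^4+2\tau^2+2)$, $A_4=4\tau^3+4\tau^2+4\tau+(\tau^4+1)(\tau^4+2\tau^2+2)$. Then - $s=1$ iff at least one of $A_1,A_2,A_3,A_4$ is divisible by $\mathfrak{p}^{13}$; - $s=2$ iff at least one of $A_1,A_2,A_3,A_4$ is in $\mathfrak{p}^{12}\setminus\mathfrak{p}^{13}$ or at least one of $A_1+\tau^8,\,A_2+\tau^8,\,A_3+\tau^8,\,A_4+\tau^8$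 is divisible by $\mathfrak{p}^{12}$; - $s=3$ otherwise. (7) If $\mathfrak{p}^7\parallel\tau^4+2$, then - $s=3$ iff $\mathfrak{p}^{13}\mid\tau^{12}+4\tau^3+2(\tau^4+2)$; - $s=4$ otherwise. (8) If $\mathfrak{p}^8\parallel\tau^4+2$, then - $s=2$ iff at least one of $(\tau^8+\tau^4+2)$, $4\tau^2+(\tau^8+\tau^4+2)$, $\tau^{12}+4\tau^3+(\tau^8+\tau^4+2)$, $\tau^{12}+4\tau^3+4\tau^2+(\tau^8+\tau^4+2)$ is divisible by $\mathfrak{p}^{13}$; - $s=3$ iff at least one of $\tau^{12}+(\tau^8+\tau^4+2)$, $\tau^{12}+4\tau^2+(\tau^8+\tau^4+2)$, $4\tau^3+(\tau^8+\tau^4+2)$, $4\tau^3+4\tau^2+(\tau^8+\tau^4+2)$ is divisible by $\mathfrak{p}^{13}$; - $s=4$ iff $\mathfrak{p}^9\parallel\tau^8+\tau^4+2$; and one of these holds. (9) If $\mathfrak{p}^9\parallel\tau^4+2$, then $s=4$. (10) If $\mathfrak{p}^{10}\parallel\tau^4+2$, then - $s=2$ iff $\mathfrak{p}^{13}$ divides $\tau^{12}+4\tau^3+4\tau^2+\tau^4+2$ or $\tau^{12}+4\tau^2+\tau^4+2$; - $s=3$ otherwise. (11) If $\mathfrak{p}^{11}\parallel\tau^4+2$, then - $s=2$ iff $\mathfrak{p}^{13}\mid 4\tau^3+\tau^4+2$; - $s=3$ otherwise. (12) If $\mathfrak{p}^{12}\parallel\tau^4+2$, then $s=3$. (13) If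 $\mathfrak{p}^{13}\mid\tau^4+2$, then $s=2$. Moreover, exactly one of the hypotheses (5)–(13) holds for any given $\tau$.
   Context: For a field $F$, the fourth level $s_4(F)$ is the smallest positive integer $g$ such that $x_1^4+\dots+x_g^4=-1$ is solvable in $F$ (and $s_4(F)=\infty$ if there is no such $g$). $K_{\mathfrak{p}}$ denotes the $\mathfrak{p}$-adic completion of $K$. For $a\in\mathcal{O}_K$ and $j\ge 0$: $\mathfrak{p}^j\mid a$ means $a\in\mathfrak{p}^j$, and $\mathfrak{p}^j\parallel a$ means $a\in\mathfrak{p}^j\setminus\mathfrak{p}^{j+1}$. *)

(* Defs.v *)
From HB Require Import structures.
From mathcomp Require Import all_boot all_order all_algebra all_field.
From mathcomp Require Import boolp classical_sets.

Set Implicit Arguments.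
Unset Strict Implicit.
Unset Printing Implicit Defensive.

Import Order.TTheory GRing.Theory Num.Theory.
Local Open Scope ring_scope.

(* A number field is a K : fieldExtType rat (a finite extension of rat). *)

Section RingOfIntegers.
Variable K : fieldExtType rat.

Definition integral_elt : {pred K} :=
  fun x => `[< integralOver (intr : int -> K) x >].

Fact integral_elt_subring : subring_closed integral_elt.
Proof.
split=> [|x y|x y]; rewrite /integral_elt !unfold_in.
- by apply/asboolP; exact: (@integral1 int K intr).
- move=> /asboolP ix /asboolP iy; apply/asboolP.
  exact: (@integral_sub int K intr).
- move=> /asboolP ix /asboolP iy; apply/asboolP.
  exact: (@integral_mul int K intr).
Qed.

HB.instance Definition _ :=
  GRing.isSubringClosed.Build K integral_elt integral_elt_subring.

Record ring_of_integers := RingOfIntegers {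
  int_val : K;
  _ : int_val \in integral_elt
}.

HB.instance Definition _ := [isSub for int_val].
HB.instance Definition _ := [Choice of ring_of_integers by <:].
HB.instance Definition _ :=
  [SubChoice_isSubComNzRing of ring_of_integers by <:].

End RingOfIntegers.

Section IdealPowers.
Local Open Scope classical_set_scope.
Variable R : comNzRingType.

Definition ideal_mul (I J : set R) : set R :=
  [set x | exists n (a b : 'I_n -> R),
     [/\ forall i, I (a i), forall i, J (b i) & x = \sum_i a i * b i]].

Fixpoint ideal_exp (I : set R) (j : nat) : set R :=
  if j is j'.+1 then ideal_mul I (ideal_exp I j') else setT.

(* p^j | a *)
Definition idvd (p : prime_idealr R) (j : nat) (a : R) : Prop :=
  ideal_exp [set` p] j a.

(* p^j || a *)
Definition idvd_exact (p : prime_idealr R) (j : nat) (a : R) : Prop :=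
  idvd p j a /\ ~ idvd p j.+1 a.

End IdealPowers.

Section PrimeInvariants.
Variables (K : fieldExtType rat) (p : prime_idealr (ring_of_integers K)).

(* p^e | (ell) means (ell) `<=` p^e, that is, ell%:R in p^e; e is the exponent
   of p in the factorization of (ell). *)
Definition has_ramification_index (ell e : nat) : Prop :=
  idvd_exact p e ell%:R.

(* O_K / p has dimension f over 'F_ell: an additive bijection between
   'F_ell-vector spaces is 'F_ell-linear. *)
Definition has_inertial_degree (ell f : nat) : Prop :=
  exists phi : {additive 'rV['F_ell]_f -> {ideal_quot p}}, bijective phi.

(* v_p(a / b) = i - j when p^i || a and p^j || b; meant for x != 0. *)
Definition has_padic_valuation (x : K) (n : int) : Prop :=
  exists (a b : ring_of_integers K) (i j : nat),
    [/\ idvd_exact p i a, idvd_exact p j b,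
        x = int_val a / int_val b & n = i%:Z - j%:Z].

(* The value of w at 0 is never used: the
   valuation of 0 is +oo. *)
Definition is_valuation (L : fieldType) (w : L -> int) : Prop :=
  (forall x y, x != 0 -> y != 0 -> w (x * y) = w x + w y) /\
  (forall x y, x != 0 -> y != 0 -> x + y != 0 ->
     Num.min (w x) (w y) <= w (x + y)).

Definition val_close (L : fieldType) (w : L -> int) (n : int) (x y : L) : Prop :=
  x = y \/ n <= w (x - y).

Definition val_complete (L : fieldType) (w : L -> int) : Prop :=
  forall u : nat -> L,
    (forall n : int, exists N : nat, forall i j : nat,
       (N <= i)%N -> (N <= j)%N -> val_close w n (u i) (u j)) ->
  exists l : L, forall n : int, exists N : nat, forall i : nat,
    (N <= i)%N -> val_close w n (u i) l.

(* A completion of K at p: a complete valued field in which K embeds densely,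
   the valuation extending v_p.  It is unique up to unique isomorphism. *)
Record padic_completion := PadicCompletion {
  completion_field :> fieldType;
  completion_embed : {rmorphism K -> completion_field};
  completion_val : completion_field -> int;
  completion_val_valuation : is_valuation completion_val;
  completion_val_extends : forall (x : K) (n : int), x != 0 ->
    (completion_val (completion_embed x) = n <-> has_padic_valuation x n);
  completion_val_complete : val_complete completion_val;
  completion_dense : forall (y : completion_field) (n : int),
    exists x : K, val_close completion_val n (completion_embed x) y
}.

End PrimeInvariants.

Section FourthLevel.
Variable F : fieldType.

Definition neg1_sum_fourth_powers (g : nat) : Prop :=
  exists x : 'I_g -> F, \sum_i x i ^+ 4 = -1.

(* None stands for an infinite fourth level. *)
Definition fourth_level : option nat :=
  match pselect (exists g, (0 < g)%N && `[< neg1_sum_fourth_powers g >]) with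
  | left exg => Some (ex_minn exg)
  | right _ => None
  end.

End FourthLevel.

(* Main.v *)
(* The completion is a complete discretely valued field with residue field F_2,
   uniformizer t and v(2) = 4.  Squaring maps 1 + p^m onto 1 + p^(m+4) for
   m >= 5, hence 1 + p^13 consists of fourth powers, and -1 is a sum of g fourth
   powers iff it is one modulo p^13.  The ring of integers modulo p^13 is
   determined by the relation t^4 = 2 (c0 + c1 t + c2 t^2 + c3 t^3) with c0 odd,
   which leaves 4^4 = 256 rings, in each of which the level and all the
   divisibilities are computed.  The valuation of the completion tells the
   powers of p apart because it takes only integer values on K^*, and its residue
   field is O_K / p because each x in K is a quotient a / b of algebraic integers
   not both in p (Horner's scheme applied to a primitive integral equation
   of x). *)
Require Import Defs.
From Stdlib Require Import BinNat Nnat.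
From HB Require Import structures.
From mathcomp Require Import all_boot all_order all_algebra all_field.
From mathcomp Require Import boolp classical_sets.
From mathcomp Require Import ring zify.

Set Implicit Arguments.
Unset Strict Implicit.
Unset Printing Implicit Defensive.

Import Order.TTheory GRing.Theory Num.Theory.
Local Open Scope ring_scope.

(** * Balls of an integer-valued valuation *)

Section ValuationBalls.
Variables (L : fieldType) (w : L -> int).
Hypothesis w_val : is_valuation w.
Implicit Types (m n : int) (x y z : L).

(** The disjunct [x == 0] gives 0 the valuation +oo, since [w 0] is an arbitrary integer. *)
Definition vball (n : int) (x : L) : bool := (x == 0) || (n <= w x).

Lemma valM x y : x != 0 -> y != 0 -> w (x * y) = w x + w y.
Proof. by case: w_val => wM _; apply: wM. Qed.

Lemma val1 : w 1 = 0.
Proof.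
have : w 1 = w 1 + w 1 by rewrite -valM ?oner_neq0 // mulr1.
by move: (w 1) => a; lia.
Qed.

Lemma valN x : w (- x) = w x.
Proof.
have [->|x0] := eqVneq x 0; first by rewrite oppr0.
have N1 : (-1 : L) != 0 by rewrite oppr_eq0 oner_eq0.
have wN1 : w (-1) = 0.
  have : 0 = w (-1) + w (-1) by rewrite -valM // mulrNN mulr1 val1.
  by move: (w (-1)) => a; lia.
by rewrite -mulN1r valM // wN1 add0r.
Qed.

Lemma valV x : x != 0 -> w x^-1 = - w x.
Proof.
move=> x0; have := valM x0 (invr_neq0 x0).
by rewrite mulfV // val1; lia.
Qed.

Lemma valX x k : x != 0 -> w (x ^+ k) = w x *+ k.
Proof.
move=> x0; elim: k => [|k IH]; first by rewrite val1.
by rewrite exprS valM ?expf_neq0 // IH mulrS.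
Qed.

Lemma vball0 n : vball n 0.
Proof. by rewrite /vball eqxx. Qed.

Lemma vballE n x : x != 0 -> vball n x = (n <= w x).
Proof. by rewrite /vball => /negPf->. Qed.

Lemma vball_le m n x : vball n x -> m <= n -> vball m x.
Proof.
by move=> /orP[/eqP->|nx] mn; rewrite /vball ?eqxx // (le_trans mn nx) orbT.
Qed.

Lemma vballD n x y : vball n x -> vball n y -> vball n (x + y).
Proof.
have [->|x0] := eqVneq x 0; first by rewrite add0r.
have [->|y0] := eqVneq y 0; first by rewrite addr0.
have [->|xy0] := eqVneq (x + y) 0; first by rewrite vball0.
rewrite !vballE // => nx ny; case: w_val => _ wD.
by rewrite (le_trans _ (wD _ _ x0 y0 xy0)) // le_min nx.
Qed.

Lemma vballN n x : vball n (- x) = vball n x.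
Proof. by rewrite /vball oppr_eq0 valN. Qed.

Lemma vballB n x y : vball n x -> vball n y -> vball n (x - y).
Proof. by move=> vx vy; rewrite vballD ?vballN. Qed.

Lemma vballBC n x y : vball n (x - y) = vball n (y - x).
Proof. by rewrite -vballN opprB. Qed.

Lemma vballM m n x y : vball m x -> vball n y -> vball (m + n) (x * y).
Proof.
have [->|x0] := eqVneq x 0; first by rewrite mul0r !vball0.
have [->|y0] := eqVneq y 0; first by rewrite mulr0 !vball0.
by rewrite !vballE ?mulf_neq0 // valM //; apply: lerD.
Qed.

Lemma vballMl n x y : vball 0 x -> vball n y -> vball n (x * y).
Proof. by move=> vx vy; rewrite -[n]add0r vballM. Qed.

Lemma vball1 : vball 0 1.
Proof. by rewrite /vball val1 lexx orbT. Qed.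

Lemma vballX n k x : vball n x -> vball (n *+ k) (x ^+ k).
Proof.
move=> vx; elim: k => [|k IH]; last by rewrite exprS mulrS vballM.
exact: vball1.
Qed.

Lemma vball0X k x : vball 0 x -> vball 0 (x ^+ k).
Proof. by move=> vx; rewrite -(mul0rn int k) vballX. Qed.

Lemma vball_nat k : vball 0 k%:R.
Proof.
elim: k => [|k IH]; first exact: vball0.
by rewrite mulrS vballD // vball1.
Qed.

Lemma vball_sum n I (r : seq I) (P : pred I) (F : I -> L) :
  (forall i, P i -> vball n (F i)) -> vball n (\sum_(i <- r | P i) F i).
Proof.
by move=> vF; elim/big_ind: _ => //; [exact: vball0 | exact: vballD].
Qed.

Lemma vball_trans n x y z : vball n (x - y) -> vball n (y - z) -> vball n (x - z).
Proof. by move=> xy yz; rewrite -[x](subrK y) -addrA vballD. Qed.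

Lemma vball_congr n x y : vball n (x - y) -> vball n x = vball n y.
Proof.
move=> xy; apply/idP/idP => v.
  by rewrite -[y](subKr x) vballB.
by rewrite -[x](subrK y) vballD.
Qed.

Lemma vball_mul2r n x y : y != 0 -> vball (n + w y) (x * y) = vball n x.
Proof.
move=> y0; have [->|x0] := eqVneq x 0; first by rewrite mul0r !vball0.
by rewrite !vballE ?mulf_neq0 // valM // lerD2r.
Qed.

Lemma vball_inf x : (forall n, vball n x) -> x = 0.
Proof.
move=> vx; apply/eqP; have := vx (w x + 1).
by rewrite /vball => /orP[//|]; lia.
Qed.

Lemma val_closeE n x y : val_close w n x y <-> vball n (x - y).
Proof.
rewrite /val_close /vball subr_eq0; split=> [[->|h]|/orP[/eqP->|h]].
- by rewrite eqxx.
- by rewrite h orbT.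
- by left.
- by right.
Qed.

End ValuationBalls.

(** * Digit expansions, Hensel lifting and reduction modulo p^13 *)

Section LocalField.
Variables (L : fieldType) (w : L -> int).
Hypothesis w_val : is_valuation w.
Local Notation V := (vball w).
Hypothesis V_residue : forall x, V 0 x -> V 1 x \/ V 1 (x - 1).

(** Digits are found one at a time: the remainder divided by [e n] is integral, and its class in F_2
    is the next digit. The family [e] is left free because both the powers of t and the elements
    [tpow m] serve below. *)
Lemma digit_expansion (e : nat -> L) (n : nat) (x : L) :
  (forall m, e m != 0 /\ w (e m) = m%:Z) -> V 0 x ->
  exists d : nat -> bool, V n%:Z (x - \sum_(m < n) (d m)%:R * e m).
Proof.
move=> he vx; elim: n => [|n [d vd]].
  by exists xpredT; rewrite big_ord0 subr0.
have [en0 wen] := he n.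
set y := _ - _ in vd.
have vy : V 0 (y / e n).
  by rewrite -(vball_mul2r w_val _ _ en0) divfK // add0r wen.
have [b vb] : exists b : bool, V 1 (y / e n - b%:R).
  by have [h|h] := V_residue vy; [exists false; rewrite subr0 | exists true].
exists (fun m => if m == n then b else d m).
rewrite big_ord_recr /= eqxx.
under eq_bigr => i _ do rewrite (ltn_eqF (ltn_ord i)).
rewrite opprD addrA -/y -[y](divfK en0) -mulrBl.
have -> : n.+1%:Z = 1 + w (e n) by rewrite wen -addn1 PoszD addrC.
by rewrite vball_mul2r.
Qed.

Hypothesis w_complete : val_complete w.
Hypotheses (two_neq0 : (2 : L) != 0) (val2 : w 2 = 4).

Lemma vball_half n x : V (n + 4) x -> V n (x / 2).
Proof. by move=> vx; rewrite -(vball_mul2r w_val _ _ two_neq0) divfK // val2. Qed.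

(** The equation says that y is a fixed point of y -> (u - y^2) / 2. This map preserves the ball of
    radius m, and since (y + y') / 2 has valuation at least m - 4 >= 1, it contracts by at least one
    power of p. The iterates from 0 form a Cauchy sequence. *)
Lemma sqrt_near_one (m : int) (u : L) : 5 <= m -> V (m + 4) u ->
  exists2 y, V m y & (1 + y) ^+ 2 = 1 + u.
Proof.
move=> m5 vu.
pose f (y : L) : L := (u - y ^+ 2) / 2.
pose y k : L := iter k f 0.
have fV z : V m z -> V m (f z).
  move=> vz; apply: vball_half; apply: vballB => //.
  by apply: vball_le (vballX w_val 2 vz) _; lia.
have yV k : V m (y k) by elim: k => [|k IH] /=; [exact: vball0 | exact: fV].
have step k : V (m + k%:Z) (y k.+1 - y k).
  elim: k => [|k IH].
    by rewrite addr0 [_ - y 0%N]subr0; exact: (yV 1%N).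
  have -> : y k.+2 - y k.+1 = - ((y k.+1 - y k) * (y k.+1 + y k) / 2).
    by rewrite /y /= -/(y k) /f; field.
  rewrite vballN //; apply: vball_half.
  have := vballM w_val IH (vballD w_val (yV k.+1) (yV k)).
  by move/vball_le; apply; lia.
have far i j : (i <= j)%N -> V (m + i%:Z) (y j - y i).
  move=> /subnK <-; elim: (j - i)%N => [|k IH].
    by rewrite subrr vball0.
  apply: (vball_trans w_val (y := y (k + i)%N)) => //.
  by apply: vball_le (step (k + i)%N) _; lia.
have [n|l hl] := w_complete (u := y).
  exists `|n|%N => i j Ni Nj; apply/val_closeE.
  apply: (vball_trans w_val (y := y `|n|%N)).
    by apply: vball_le (far _ _ Ni) _; lia.
  by rewrite vballBC //; apply: vball_le (far _ _ Nj) _; lia.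
have lim n : exists N, forall i, (N <= i)%N -> V n (y i - l).
  by have [N hN] := hl n; exists N => i /hN /val_closeE.
have vl : V m l.
  have [N /(_ N (leqnn _))] := lim m.
  by move/(vball_congr w_val) <-.
exists l => //.
(* The defect of the limit l lies in every ball: u = 2 y_{N+1} + y_N^2 expresses it through y_N - l
   and y_{N+1} - l. *)
suff e : l ^+ 2 + 2 * l - u = 0 by rewrite -[u]addr0 -e; ring.
apply: (vball_inf (w := w)) => n; have [N hN] := lim n.
have -> : l ^+ 2 + 2 * l - u
    = - ((y N - l) * (y N + l)) - 2 * (y N.+1 - l).
  by rewrite /y /= -/(y N) /f; field.
have V0y k : V 0 (y k) by apply: vball_le (yV k) _; lia.
apply: vballB => //.
  rewrite vballN // mulrC; apply: vballMl; rewrite ?hN //.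
  by apply: vballD => //; apply: vball_le vl _; lia.
by apply: vballMl; rewrite ?vball_nat ?hN.
Qed.

(** Each square root costs a radius of 4, and the last one must land at radius at least 5; this is
    the origin of 13 = 5 + 4 + 4. *)
Lemma fourth_root_near_one u : V 13 u -> exists y, y ^+ 4 = 1 + u.
Proof.
move=> vu; have [||y vy ey] := @sqrt_near_one 9 u => //.
have [||z _ ez] := @sqrt_near_one 5 y => //.
by exists (1 + z); rewrite (exprM _ 2 2) ez.
Qed.

(* Dividing the equation by the term of largest denominator makes it integral. *)
Lemma neg1_sum_integral g : neg1_sum_fourth_powers L g ->
  exists2 x : 'I_g -> L, forall i, V 0 (x i) & \sum_i x i ^+ 4 = -1.
Proof.
move=> [x ex]; have [/forallP vx|] := boolP [forall i, V 0 (x i)].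
  by exists x.
rewrite negb_forall => /existsP[i0 ni0].
have xi0 : x i0 != 0 by apply: contraNneq ni0 => ->; rewrite vball0.
case: (arg_minP (fun i => w (x i)) (i0 := i0) (P := fun i => x i != 0)) => // j xj jmin.
have wj : w (x j) < 0.
  by apply: le_lt_trans (jmin i0 xi0) _; move: ni0; rewrite vballE // -ltNge.
(* After dividing sum + 1 = 0 by x_j^4, the old summand 1 becomes (1 / x_j)^4 and x_j^4 becomes the
   new 1; hence 1 / x_j takes the place of x_j. *)
exists (fun i => if i == j then (x j)^-1 else x i / x j).
  move=> i; case: ifP => _.
    by rewrite vballE ?invr_eq0 // valV //; lia.
  rewrite -(vball_mul2r w_val _ _ xj) divfK // add0r /vball.
  by case: eqVneq => //= /jmin.
apply: (mulIf (expf_neq0 4 xj)).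
rewrite (bigD1 j) //= eqxx mulrDl exprVn mulVf ?expf_neq0 // mulr_suml.
under eq_bigr => i /negPf -> do rewrite exprMn exprVn divfK ?expf_neq0 //.
move: ex; rewrite (bigD1 j) //=; set s := \sum_(_ < _ | _) _ => ex.
by rewrite mulN1r -[1]opprK -ex; ring.
Qed.

(** From an approximate solution with sum s, some x_j is a unit, and multiplying it by a fourth root
    of 1 - (s + 1) / x_j^4 absorbs the whole error. *)
Lemma neg1_sum_approx g :
  neg1_sum_fourth_powers L g <->
  exists2 x : 'I_g -> L, forall i, V 0 (x i) & V 13 (\sum_i x i ^+ 4 + 1).
Proof.
split=> [/neg1_sum_integral[x vx ex]|[x vx ex]].
  by exists x; rewrite // ex addNr vball0.
(* If no x_i were a unit, the sum would lie in the ball of radius 1, and so would 1. *)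
have [/forallP v1|] := boolP [forall i, V 1 (x i)].
  have v : V 1 (\sum_i x i ^+ 4).
    by apply: vball_sum => // i _; apply: vball_le (vballX w_val 4 (v1 i)) _.
  have : V 1 1.
    by rewrite -[X in V _ X](addKr (\sum_i x i ^+ 4)) addrC vballB //; apply: vball_le ex _.
  by rewrite vballE ?oner_neq0 // val1.
rewrite negb_forall => /existsP[j nj].
have xj : x j != 0 by apply: contraNneq nj => ->; rewrite vball0.
have wj : w (x j) = 0.
  move: nj (vx j); rewrite !vballE //; lia.
set s := \sum_i _ in ex.
have [|y ey] := @fourth_root_near_one (- ((s + 1) / x j ^+ 4)).
  rewrite vballN // -(vball_mul2r w_val _ _ (expf_neq0 4 xj)) divfK ?expf_neq0 //.
  by rewrite valX // wj mul0rn addr0.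
exists (fun i => if i == j then x j * y else x i).
rewrite (bigD1 j) //= eqxx exprMn ey.
under eq_bigr => i /negPf -> do [].
have -> : s = x j ^+ 4 + \sum_(i < g | i != j) x i ^+ 4 by rewrite /s (bigD1 j).
by field.
Qed.

End LocalField.

(** * Computable arithmetic modulo t^13 *)

(* (x0, x1, x2, x3) stands for x0 + x1 t + x2 t^2 + x3 t^3 modulo t^13, where
   16, 8 t, 8 t^2 and 8 t^3 vanish. *)
Definition quad : Type := (N * N * N * N)%type.

Definition quad_red (x : quad) : quad :=
  let: (x0, x1, x2, x3) := x in
  (N.land x0 15, N.land x1 7, N.land x2 7, N.land x3 7)%num.

Definition quad_add (x y : quad) : quad :=
  let: (x0, x1, x2, x3) := x in let: (y0, y1, y2, y3) := y in
  quad_red (x0 + y0, x1 + y1, x2 + y2, x3 + y3)%num.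

Definition quad_scale (n : N) (x : quad) : quad :=
  let: (x0, x1, x2, x3) := x in quad_red (n * x0, n * x1, n * x2, n * x3)%num.

(* Multiplication by t, for the relation t^4 = 2 (c0 + c1 t + c2 t^2 + c3 t^3). *)
Definition quad_shift (c x : quad) : quad :=
  let: (x0, x1, x2, x3) := x in
  quad_add (0, x0, x1, x2)%num (quad_scale (2 * x3)%num c).

Definition quad_mul (c x y : quad) : quad :=
  let: (x0, x1, x2, x3) := x in
  quad_add (quad_scale x0 y) (quad_shift c (quad_add (quad_scale x1 y)
    (quad_shift c (quad_add (quad_scale x2 y) (quad_shift c (quad_scale x3 y)))))).

Definition quad_horner (c : quad) (l : seq N) : quad :=
  foldr (fun a r => quad_add (a, 0, 0, 0)%num (quad_shift c r))
    (0, 0, 0, 0)%num l.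

(** The binary digits of the entries are read in the order of 1, t, t^2, t^3, 2, 2 t, 2 t^2, and so
    on, whose valuations are 0, 1, 2, ...; the first nonzero digit gives the valuation, whatever the
    relation [c]. A reduced quadruple has 4 + 3 + 3 + 3 = 13 digits. *)
Fixpoint quad_dvd (k : nat) (x : quad) : bool :=
  if k is k'.+1 then
    let: (x0, x1, x2, x3) := x in
    ~~ N.odd x0 && quad_dvd k' (x1, x2, x3, N.div2 x0)
  else true.

Fixpoint bit_lists (n : nat) : seq (seq N) :=
  if n is n'.+1 then
    [seq 0%num :: l | l <- bit_lists n'] ++ [seq 1%num :: l | l <- bit_lists n']
  else [:: [::]].

Definition quad_pow4 (c x : quad) : quad :=
  let y := quad_mul c x x in quad_mul c y y.

Definition quad_pow4s (c : quad) : seq quad :=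
  undup [seq quad_pow4 c (quad_horner c l) | l <- bit_lists 5].

Definition quad_sums (s1 s2 : seq quad) : seq quad :=
  undup (allpairs quad_add s1 s2).

Definition neg1_in_sums (s1 s2 : seq quad) : bool :=
  has (fun x => let x1 := quad_add (1, 0, 0, 0)%num x in
                has (fun y => quad_dvd 13 (quad_add x1 y)) s2) s1.

(** The sums of at most four fourth powers are tested by halves: 0 + 1, 1 + 1, 1 + 2 and 2 + 2
    terms. The final value 5 only records that all four tests failed. *)
Definition quad_level (c : quad) : nat :=
  let s1 := quad_pow4s c in
  if neg1_in_sums [:: (0, 0, 0, 0)%num] s1 then 1 else
  if neg1_in_sums s1 s1 then 2 else
  let s2 := quad_sums s1 s1 in
  if neg1_in_sums s1 s2 then 3 else
  if neg1_in_sums s2 s2 then 4 else 5.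

Definition natN (R : nzRingType) (a : N) : R := (N.to_nat a)%:R.

(** Stated over any ring, so that one coefficient list can be evaluated both at tau in O_K and at
    its image in the completion. *)
Definition hornerN (R : nzRingType) (t : R) (l : seq N) : R :=
  foldr (fun a r => natN R a + t * r) 0 l.

Lemma rmorph_hornerN (R S : nzRingType) (f : {rmorphism R -> S}) t l :
  f (hornerN t l) = hornerN (f t) l.
Proof.
elim: l => [|a l IH] /=; first exact: rmorph0.
by rewrite rmorphD rmorphM rmorph_nat IH.
Qed.

(** * Evaluation of quadruples in the valued field *)

Section QuadSemantics.
Variables (L : fieldType) (w : L -> int).
Hypothesis w_val : is_valuation w.
Local Notation V := (vball w).
Variable t : L.
Hypotheses (t_neq0 : t != 0) (val_t : w t = 1).
Hypotheses (two_neq0 : (2 : L) != 0) (val2 : w 2 = 4).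

Local Notation natN := (natN L).
Local Notation hornerN := (hornerN t).

Lemma natND (a b : N) : natN (a + b)%num = natN a + natN b.
Proof. by rewrite /natN Nnat.N2Nat.inj_add natrD. Qed.

Lemma natNM (a b : N) : natN (a * b)%num = natN a * natN b.
Proof. by rewrite /natN Nnat.N2Nat.inj_mul natrM. Qed.

Definition ev (x : quad) : L :=
  let: (x0, x1, x2, x3) := x in
  natN x0 + natN x1 * t + natN x2 * t ^+ 2 + natN x3 * t ^+ 3.

Lemma vball_t k : V k%:Z (t ^+ k).
Proof. by rewrite /vball valX // val_t; apply/orP; right; lia. Qed.

Lemma vball_2 k : V (4 * k%:Z) (2 ^+ k).
Proof. by rewrite /vball valX // val2; apply/orP; right; lia. Qed.

Lemma vball_t0 k : V 0 (t ^+ k).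
Proof. by apply: vball_le (vball_t k) _. Qed.

Lemma vball_natN a : V 0 (natN a).
Proof. exact: vball_nat. Qed.

Lemma vball_ev x : V 0 (ev x).
Proof.
case: x => [[[x0 x1] x2] x3] /=.
have M a k : V 0 (natN a * t ^+ k).
  by apply: vballMl; rewrite ?vball_natN ?vball_t0.
by rewrite -[t in X in V _ X]expr1 !vballD ?vball_natN.
Qed.

Local Notation "x '≡' y" := (V 13 (x - y)) (at level 70).

Lemma eqv_refl x : x ≡ x. Proof. by rewrite subrr vball0. Qed.

Lemma eqv_trans x y z : x ≡ y -> y ≡ z -> x ≡ z.
Proof. exact: vball_trans. Qed.

Lemma eqv_sym x y : x ≡ y -> y ≡ x.
Proof. by rewrite vballBC. Qed.

Lemma eqvD x y x' y' : x ≡ x' -> y ≡ y' -> x + y ≡ x' + y'.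
Proof. by move=> h h'; rewrite opprD addrACA vballD. Qed.

Lemma eqvMl a x y : V 0 a -> x ≡ y -> a * x ≡ a * y.
Proof. by move=> va h; rewrite -mulrBr vballMl. Qed.

Lemma eqvM x y x' y' : V 0 x -> V 0 y' ->
  x ≡ x' -> y ≡ y' -> x * y ≡ x' * y'.
Proof.
move=> vx vy' h h'; apply: eqv_trans (eqvMl vx h') _.
by rewrite ![_ * y']mulrC eqvMl.
Qed.

Lemma natN_land a k :
  exists q : nat, natN a = natN (N.land a (N.ones k)) + 2 ^+ N.to_nat k * q%:R.
Proof.
exists (N.to_nat (a / 2 ^ k)%num).
rewrite BinNat.N.land_ones {1}(BinNat.N.div_mod a (2 ^ k)%num); last first.
  exact: BinNat.N.pow_nonzero.
rewrite natND natNM addrC; congr (_ + _ * _).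
elim/BinNat.N.peano_ind: k => [//|k IH].
by rewrite BinNat.N.pow_succ_r' natNM IH Nnat.N2Nat.inj_succ exprS.
Qed.

(** The discarded parts are multiples of 2^4, of valuation 16, and of 2^3 t^i with i >= 1, of
    valuation 12 + i >= 13. *)
Lemma ev_red x : ev (quad_red x) ≡ ev x.
Proof.
case: x => [[[x0 x1] x2] x3] /=.
have [q0 e0] := natN_land x0 4; have [q1 e1] := natN_land x1 3.
have [q2 e2] := natN_land x2 3; have [q3 e3] := natN_land x3 3.
rewrite e0 e1 e2 e3 /=.
set d := _ - _.
have -> : d = - (2 ^+ 4 * q0%:R) - (2 ^+ 3 * t ^+ 1) * q1%:R
    - (2 ^+ 3 * t ^+ 2) * q2%:R - (2 ^+ 3 * t ^+ 3) * q3%:R.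
  by rewrite /d expr1; ring.
have M i (q : nat) : (0 < i)%N -> V 13 (2 ^+ 3 * t ^+ i * q%:R).
  move=> i0; rewrite mulrC; apply: vballMl; rewrite ?vball_nat //.
  by apply: vball_le (vballM w_val (vball_2 3) (vball_t i)) _; lia.
rewrite !vballB ?M // vballN // mulrC; apply: vballMl; rewrite ?vball_nat //.
exact: vball_le (vball_2 4) _.
Qed.

Lemma ev_add x y : ev (quad_add x y) ≡ ev x + ev y.
Proof.
case: x => [[[x0 x1] x2] x3]; case: y => [[[y0 y1] y2] y3].
apply: eqv_trans (ev_red _) _.
by rewrite /= !natND (_ : _ - _ = 0) ?vball0 //; ring.
Qed.

Lemma ev_scale a x : ev (quad_scale a x) ≡ natN a * ev x.
Proof.
case: x => [[[x0 x1] x2] x3].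
apply: eqv_trans (ev_red _) _.
by rewrite /= !natNM (_ : _ - _ = 0) ?vball0 //; ring.
Qed.

(* The elements 2 ^ (m / 4) * t ^ (m mod 4) have valuation m, and dividing the
   leading one out of an even quadruple permutes its entries cyclically. *)
Definition tpow (m : nat) : L := 2 ^+ (m %/ 4) * t ^+ (m %% 4).

Lemma tpow_neq0 m : tpow m != 0.
Proof. by rewrite mulf_neq0 ?expf_neq0. Qed.

Lemma val_tpow m : w (tpow m) = m%:Z.
Proof.
rewrite valM ?expf_neq0 // !valX // val2 val_t.
by rewrite [in RHS](divn_eq m 4); lia.
Qed.

Lemma tpow4 m : tpow (m + 4) = 2 * tpow m.
Proof. by rewrite /tpow modnDr divnDr // addn1 exprS mulrA. Qed.

Definition ev_at (j : nat) (x : quad) : L :=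
  let: (x0, x1, x2, x3) := x in
  natN x0 * tpow j + natN x1 * tpow (j + 1)
  + natN x2 * tpow (j + 2) + natN x3 * tpow (j + 3).

Lemma vball_ev_at j k x : V (j + k)%:Z (ev_at j x) = quad_dvd k x.
Proof.
have vt a m n : (m <= n)%N -> V m%:Z (natN a * tpow n).
  move=> mn; apply: vballMl; rewrite ?vball_natN // vballE ?tpow_neq0 //.
  by rewrite val_tpow.
elim: k j x => [|k IH] j [[[x0 x1] x2] x3].
  by rewrite addn0 /= !vballD ?vt ?leq_addr.
have e0 : natN x0 = 2 * natN (N.div2 x0) + (N.odd x0)%:R.
  rewrite [in LHS](BinNat.N.div2_odd x0) natND natNM.
  by case: (N.odd x0).
have -> : ev_at j (x0, x1, x2, x3)
    = ev_at (j + 1) (x1, x2, x3, N.div2 x0) + (N.odd x0)%:R * tpow j.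
  by rewrite /= e0 -!addnA tpow4; ring.
rewrite [quad_dvd _ _]/=; case: (N.odd x0); rewrite [~~ _]/= ?andTb ?andFb; last first.
  by rewrite mul0r addr0 -(IH (j + 1)%N) addn1 addSnnS.
(* For odd [x0], everything except [tpow j] lies in the ball of radius j + 1, so the assumed
   membership would put [tpow j], of valuation j, there too. *)
rewrite mul1r; apply/negP => v.
have {}v : V (j + 1)%:Z (tpow j).
  rewrite -(vball_congr w_val (x := ev_at (j + 1) (x1, x2, x3, N.div2 x0) + tpow j)).
    by apply: vball_le v _; lia.
  by rewrite addrK /= !vballD ?vt // !leq_addr.
by move: v; rewrite vballE ?tpow_neq0 // val_tpow; lia.
Qed.

Lemma vball_evE k x : V k%:Z (ev x) = quad_dvd k x.
Proof.
rewrite -(vball_ev_at 0); case: x => [[[x0 x1] x2] x3] /=.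
by rewrite /tpow !mul1r mulr1 expr1.
Qed.

Variable c : quad.
Hypothesis t_rel : t ^+ 4 ≡ 2 * ev c.

Lemma ev_shift x : ev (quad_shift c x) ≡ t * ev x.
Proof.
case: x => [[[x0 x1] x2] x3].
apply: eqv_trans (ev_add _ _) _.
apply: (eqv_trans (y := ev (0, x0, x1, x2)%num + natN x3 * (2 * ev c))).
  apply: eqvD; rewrite ?eqv_refl //; apply: eqv_trans (ev_scale _ _) _.
  by rewrite natNM (_ : natN 2 = 2) // (_ : _ - _ = 0) ?vball0 //; ring.
apply: (eqv_trans (y := ev (0, x0, x1, x2)%num + natN x3 * t ^+ 4)).
  by apply: eqvD; rewrite ?eqv_refl // eqvMl ?vball_natN // eqv_sym.
by rewrite /= (_ : natN 0 = 0) // (_ : _ - _ = 0) ?vball0 //; ring.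
Qed.

Lemma ev_mul x y : ev (quad_mul c x y) ≡ ev x * ev y.
Proof.
case: x => [[[x0 x1] x2] x3].
have step a u z : ev u ≡ z ->
    ev (quad_add (quad_scale a y) (quad_shift c u)) ≡ natN a * ev y + t * z.
  move=> uz; apply: eqv_trans (ev_add _ _) _.
  apply: eqvD; first exact: ev_scale.
  by apply: eqv_trans (ev_shift _) _; rewrite eqvMl // (vball_t0 1).
apply: eqv_trans (step _ _ _ (step _ _ _ (step _ _ _ (ev_scale _ _)))) _.
by rewrite /= (_ : _ - _ = 0) ?vball0 //; ring.
Qed.

Lemma ev_pow4 x : ev (quad_pow4 c x) ≡ ev x ^+ 4.
Proof.
apply: eqv_trans (ev_mul _ _) _; rewrite (exprM _ 2 2) [_ ^+ 2]expr2.
rewrite [ev x ^+ 2]expr2.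
by apply: eqvM; rewrite ?ev_mul ?vball_ev // vballMl ?vball_ev.
Qed.

Arguments quad_add : simpl never.

Lemma ev_horner l : ev (quad_horner c l) ≡ hornerN l.
Proof.
elim: l => [|a l IH] /=.
  by rewrite (_ : natN 0 = 0) // !mul0r !addr0 subrr vball0.
apply: eqv_trans (ev_add _ _) _; apply: eqvD.
  by rewrite /= (_ : natN 0 = 0) // !mul0r !addr0 subrr vball0.
by apply: eqv_trans (ev_shift _) _; rewrite eqvMl // (vball_t0 1).
Qed.

Lemma vball_hornerE k l : (k <= 13)%N ->
  V k%:Z (hornerN l) = quad_dvd k (quad_horner c l).
Proof.
move=> k13; rewrite -vball_evE; apply: vball_congr => //.
by rewrite vballBC //; apply: vball_le (ev_horner l) _; lia.
Qed.

End QuadSemantics.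

(** * The fourth level of the field from the computed level *)

Lemma fourth_level_eq (F : fieldType) (g : nat) : (0 < g)%N ->
  neg1_sum_fourth_powers F g ->
  (forall h, (0 < h < g)%N -> ~ neg1_sum_fourth_powers F h) ->
  fourth_level F = Some g.
Proof.
move=> g0 hg hmin; rewrite /fourth_level.
case: pselect => [exg|]; last by case; exists g; rewrite g0; apply/asboolP.
congr Some; case: ex_minnP => m /andP[m0 /asboolP hm] mle.
apply/eqP; rewrite eqn_leq mle ?g0 /=; last exact/asboolP.
by rewrite leqNgt; apply/negP => mg; apply: (hmin m); rewrite ?m0.
Qed.

(* The unit t^4 / 2 matters modulo t^9 only. *)
Definition quad_relations : seq quad :=
  allpairs pair (allpairs pair (allpairs pair [:: 1; 3; 5; 7]%num
    [:: 0; 1; 2; 3]%num) [:: 0; 1; 2; 3]%num) [:: 0; 1; 2; 3]%num.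

Section QuadLevel.
Variables (L : fieldType) (w : L -> int).
Hypothesis w_val : is_valuation w.
Local Notation V := (vball w).
Hypothesis V_residue : forall x, V 0 x -> V 1 x \/ V 1 (x - 1).
Hypothesis w_complete : val_complete w.
Variable t : L.
Hypotheses (t_neq0 : t != 0) (val_t : w t = 1).
Hypotheses (two_neq0 : (2 : L) != 0) (val2 : w 2 = 4).
Local Notation ev := (ev t).
Local Notation "x '≡' y" := (V 13 (x - y)) (at level 70).

Lemma natN_b2n (b : bool) : natN L (N.b2n b) = b%:R.
Proof. by case: b. Qed.

(** The unit t^4 / 2 is expanded to nine digits along the elements [tpow m]. Its leading digit is 1
    because it is a unit, and multiplying by 2 raises the precision from 9 to 9 + 4 = 13. *)
Lemma exists_relation : exists2 c, c \in quad_relations & t ^+ 4 ≡ 2 * ev c.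
Proof.
have wx : w (t ^+ 4 / 2) = 0.
  by rewrite valM ?invr_eq0 ?expf_neq0 // valV // valX // val_t val2; lia.
have vx : V 0 (t ^+ 4 / 2) by rewrite /vball wx lexx orbT.
have tp m : tpow t m != 0 /\ w (tpow t m) = m%:Z by rewrite tpow_neq0 // val_tpow.
have [d vd] := digit_expansion w_val V_residue 9 tp vx.
rewrite !big_ord_recr big_ord0 /= add0r in vd.
have d0 : d 0%N = true.
  apply: contraTT isT => /negPf d0; move: vd; rewrite d0 mul0r add0r => vd.
  have : V 1 (t ^+ 4 / 2).
    have M m : (0 < m)%N -> V 1 ((d m)%:R * tpow t m).
      move=> m0; apply: vballMl; rewrite ?vball_nat // vballE ?tpow_neq0 //.
      by rewrite val_tpow.
    rewrite -[X in V _ X](subrK (\sum_(m < 8) (d m.+1)%:R * tpow t m.+1)).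
    apply: vballD => //; last by apply: vball_sum => // i _; apply: M.
    by rewrite !big_ord_recr big_ord0 /= add0r; apply: vball_le vd _.
  by rewrite vballE ?wx // mulf_neq0 ?invr_eq0 ?expf_neq0.
pose b i := N.b2n (d i).
(* Digits whose indices agree modulo 4 belong to the same power of t, and index m carries the factor
   2^(m / 4). *)
pose c : quad := ((1 + 2 * b 4 + 4 * b 8), (b 1 + 2 * b 5), (b 2 + 2 * b 6),
  (b 3 + 2 * b 7))%num.
exists c.
  by do ![apply: allpairs_f]; rewrite /b;
    [case: (d 4); case: (d 8) | case: (d 1); case: (d 5)
    | case: (d 2); case: (d 6) | case: (d 3); case: (d 7)].
have ec : ev c = 1 + 2 * (d 4)%:R + 4 * (d 8)%:R + ((d 1)%:R + 2 * (d 5)%:R) * t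
    + ((d 2)%:R + 2 * (d 6)%:R) * t ^+ 2 + ((d 3)%:R + 2 * (d 7)%:R) * t ^+ 3.
  have evE x0 x1 x2 x3 : ev (x0, x1, x2, x3) = natN L x0 + natN L x1 * t
      + natN L x2 * t ^+ 2 + natN L x3 * t ^+ 3 by [].
  by rewrite evE !natND !natNM !natN_b2n.
have -> : t ^+ 4 - 2 * ev c = (t ^+ 4 / 2 - ev c) * 2 by field.
have -> : 13 = 9 + w 2 by rewrite val2.
rewrite vball_mul2r //.
move: vd; congr (V _ (_ - _)).
by rewrite ec d0 /tpow /=; ring.
Qed.

(** For x = y + h with h of valuation at least 5, x^4 - y^4 = h (4 y^3 + 6 y^2 h + 4 y h^2 + h^3).
    The second factor has valuation at least 8, the term 4 y^3 being the critical one, and 5 + 8 =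
    13. So five digits of x suffice. *)
Lemma pow4_digits x : V 0 x ->
  exists2 l, l \in bit_lists 5 & x ^+ 4 ≡ hornerN t l ^+ 4.
Proof.
move=> vx.
have tp m : t ^+ m != 0 /\ w (t ^+ m) = m%:Z.
  by rewrite expf_neq0 // valX // val_t; split=> //; lia.
have [d vd] := digit_expansion w_val V_residue 5 tp vx.
pose b i := N.b2n (d i).
exists [:: b 0; b 1; b 2; b 3; b 4]%N.
  by rewrite /b; case: (d 0); case: (d 1); case: (d 2); case: (d 3); case: (d 4).
have vl l : V 0 (hornerN t l).
  elim: l => [|a l IH] /=; first exact: vball0.
  apply: vballD; rewrite ?vball_natN //; apply: vballMl => //.
  by rewrite -(expr1 t) vball_t0.
set y := hornerN _ _.
have {}vd : V 5 (x - y).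
  move: vd; congr (V _ (_ - _)).
  by rewrite !big_ord_recr big_ord0 /= /y /= !natN_b2n; ring.
have -> : x ^+ 4 - y ^+ 4 = (x - y) * (2 ^+ 2 * y ^+ 3
    + 2 * (x - y) * (3 * y ^+ 2) + (2 ^+ 2 * (x - y)) * (y * (x - y))
    + (x - y) ^+ 3) by ring.
have vy k : V 0 (y ^+ k) by rewrite vball0X // vl.
have v2 : V 8 (2 ^+ 2) by exact: (vball_2 w_val t_neq0 val_t two_neq0 val2 2).
have v2' : V 4 2 by exact: (vball_2 w_val t_neq0 val_t two_neq0 val2 1).
apply: (vballM w_val (m := 5) (n := 8)) => //; rewrite !vballD //.
- by rewrite mulrC vballMl.
- rewrite mulrC vballMl //; first by rewrite vballMl // vball_nat.
  by apply: vball_le (vballM w_val v2' vd) _.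
- rewrite mulrC vballMl //.
    by rewrite vballMl //; [exact: (vy 1%N) | apply: vball_le vd _].
  by apply: vball_le (vballM w_val v2 vd) _.
- by apply: vball_le (vballX w_val 3 vd) _.
Qed.

Variable c : quad.
Hypothesis t_rel : t ^+ 4 ≡ 2 * ev c.

(** The first clause serves to refute the existence of a sum, the second to realize one. *)
Definition covers (g : nat) (s : seq quad) : Prop :=
  (forall x : 'I_g -> L, (forall i, V 0 (x i)) ->
     exists2 a, a \in s & \sum_i x i ^+ 4 ≡ ev a) /\
  (forall a, a \in s ->
     exists2 x : 'I_g -> L, forall i, V 0 (x i) & \sum_i x i ^+ 4 ≡ ev a).

Lemma ev0 : ev (0, 0, 0, 0)%num = 0.
Proof. by rewrite /= (_ : natN L 0 = 0) // !mul0r !addr0. Qed.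

(** The empty sum is one of the two halves when a single fourth power is tested. *)
Lemma covers0 : covers 0 [:: (0, 0, 0, 0)%num].
Proof.
split=> [x vx|a].
  by exists (0, 0, 0, 0)%num; rewrite ?mem_head // big_ord0 ev0 subrr vball0.
rewrite inE => /eqP->; exists (fun=> 0) => [i|]; first exact: vball0.
by rewrite big_ord0 ev0 subrr vball0.
Qed.

Lemma ev_pow4_horner l :
  ev (quad_pow4 c (quad_horner c l)) ≡ hornerN t l ^+ 4.
Proof.
have evh := ev_horner w_val t_neq0 val_t two_neq0 val2 t_rel l.
apply: vball_trans (ev_pow4 w_val t_neq0 val_t two_neq0 val2 t_rel _) _ => //.
set u := ev _ in evh *; set v := hornerN _ _ in evh *.
have -> : u ^+ 4 - v ^+ 4 = ((u + v) * (u ^+ 2 + v ^+ 2)) * (u - v) by ring.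
have vu : V 0 u by apply: vball_ev.
have vv : V 0 v by rewrite -(vball_congr w_val (vball_le evh _)).
by rewrite vballMl // vballMl // vballD // vball0X.
Qed.

Lemma covers1 : covers 1 (quad_pow4s c).
Proof.
split=> [x vx|a].
  have [l ll xl] := pow4_digits (vx ord0).
  exists (quad_pow4 c (quad_horner c l)).
    by rewrite mem_undup; apply/mapP; exists l.
  rewrite big_ord1; apply: (vball_trans w_val xl).
  by rewrite vballBC // ev_pow4_horner.
rewrite mem_undup => /mapP[l _ ->].
exists (fun=> ev (quad_horner c l)) => [i|]; first exact: vball_ev.
by rewrite big_ord1 vballBC //; apply: ev_pow4.
Qed.

Lemma covers_add g h s s' :
  covers g s -> covers h s' -> covers (g + h) (quad_sums s s').
Proof.
move=> [gs sg] [hs sh]; split=> [x vx|a].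
  have [a as_ xa] := gs (fun i => x (lshift h i)) (fun i => vx _).
  have [a' as' xa'] := hs (fun i => x (rshift g i)) (fun i => vx _).
  exists (quad_add a a'); first by rewrite mem_undup allpairs_f.
  rewrite big_split_ord.
  apply: vball_trans (eqvD w_val xa xa') _ => //.
  by rewrite vballBC //; apply: ev_add.
rewrite mem_undup => /allpairsP[[b b'] [/= /sg[y vy yb] /sh[z vz zb] ->]].
exists (fun i => match split i with inl j => y j | inr j => z j end).
  by move=> i; case: split.
rewrite big_split_ord /=.
under eq_bigr do rewrite (unsplitK (inl _)).
under [X in _ + X - _]eq_bigr do rewrite (unsplitK (inr _)).
apply: vball_trans (eqvD w_val yb zb) _ => //.
by rewrite vballBC //; apply: ev_add.
Qed.

(** By [neg1_sum_approx] only sums modulo t^13 of integral fourth powers matter, and such a sum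
    splits into its first g and last h terms, each represented by a listed quadruple. *)
Lemma neg1_in_sumsP g h s s' : covers g s -> covers h s' ->
  neg1_sum_fourth_powers L (g + h) <-> neg1_in_sums s s'.
Proof.
move=> [gs sg] [hs sh].
have key a b z z' : z ≡ ev a -> z' ≡ ev b ->
    quad_dvd 13 (quad_add (quad_add (1, 0, 0, 0)%num a) b) = V 13 (z + z' + 1).
  move=> za zb.
  rewrite -(vball_evE w_val t_neq0 val_t two_neq0 val2).
  apply/esym/vball_congr => //.
  rewrite vballBC //; apply: vball_trans (ev_add _ _ _ _ _ _ _) _ => //.
  have -> : z + z' + 1 = (1 + z) + z' by ring.
  apply: eqvD => //; last by rewrite vballBC.
  apply: vball_trans (ev_add _ _ _ _ _ _ _) _ => //.
  apply: eqvD => //; last by rewrite vballBC.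
  by rewrite /= (_ : natN L 0 = 0) // !mul0r !addr0 subrr vball0.
rewrite (neg1_sum_approx w_val w_complete two_neq0 val2); split.
  move=> [x vx]; rewrite big_split_ord.
  have [a as_ xa] := gs (fun i => x (lshift h i)) (fun i => vx _).
  have [b bs xb] := hs (fun i => x (rshift g i)) (fun i => vx _).
  rewrite -(key _ _ _ _ xa xb) => kab.
  by apply/hasP; exists a => //=; apply/hasP; exists b.
case/hasP=> a /sg[y vy ya] /hasP[b /sh[z vz zb]].
rewrite (key _ _ _ _ ya zb) => v.
exists (fun i => match split i with inl j => y j | inr j => z j end).
  by move=> i; case: split.
rewrite big_split_ord /=.
under eq_bigr do rewrite (unsplitK (inl _)).
by under [X in _ + X + _]eq_bigr do rewrite (unsplitK (inr _)).
Qed.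

Lemma quad_levelP : (quad_level c <= 4)%N ->
  fourth_level L = Some (quad_level c).
Proof.
have c1 := covers1; have c2 := covers_add c1 c1.
have n1 := neg1_in_sumsP covers0 c1; have n2 := neg1_in_sumsP c1 c1.
have n3 := neg1_in_sumsP c1 c2; have n4 := neg1_in_sumsP c2 c2.
rewrite /quad_level.
case: ifP => [h1 _|h1].
  by apply: fourth_level_eq => // [|[|k]] //; apply/n1.
case: ifP => [h2 _|h2].
  apply: fourth_level_eq => // [|[|[|k]]] //; first exact/n2.
  by rewrite n1 h1.
case: ifP => [h3 _|h3].
  apply: fourth_level_eq => // [|[|[|[|k]]]] //; first exact/n3.
    by rewrite n1 h1.
  by rewrite n2 h2.
case: ifP => [h4 _|//].
apply: fourth_level_eq => // [|[|[|[|[|k]]]]] //; first exact/n4.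
- by rewrite n1 h1.
- by rewrite n2 h2.
- by rewrite n3 h3.
Qed.

End QuadLevel.

(** * Powers of an ideal *)

Section IdealPowers.
Variable R : comNzRingType.

Definition is_ideal (J : set R) : Prop :=
  [/\ J 0, forall x y, J x -> J y -> J (x + y) & forall a x, J x -> J (a * x)].

Lemma ideal_mul_ideal (I J : set R) : is_ideal J -> is_ideal (ideal_mul I J).
Proof.
move=> [_ _ JM]; split.
- by exists 0%N, (fun=> 0), (fun=> 0); split=> [[]|[]|]; rewrite ?big_ord0.
- move=> _ _ [n [a [b [aI bJ ->]]]] [m [a' [b' [aI' bJ' ->]]]].
  exists (n + m)%N, (fun i => match split i with inl j => a j | inr j => a' j end),
    (fun i => match split i with inl j => b j | inr j => b' j end).
  split=> [i|i|]; [by case: split | by case: split |].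
  rewrite big_split_ord /=; congr (_ + _); apply: eq_bigr => i _.
    by rewrite (unsplitK (inl _)).
  by rewrite (unsplitK (inr _)).
- move=> c _ [n [a [b [aI bJ ->]]]]; exists n, a, (fun i => c * b i).
  split=> [//|i|]; first exact: JM.
  by rewrite mulr_sumr; apply: eq_bigr => i _; rewrite mulrCA.
Qed.

Lemma ideal_exp_ideal (I : set R) j : is_ideal (ideal_exp I j).
Proof. by elim: j => [|j IH] //=; apply: ideal_mul_ideal. Qed.

Lemma ideal_expS (I : set R) j x : ideal_exp I j.+1 x -> ideal_exp I j x.
Proof.
move=> [n [a [b [_ bJ ->]]]]; have [J0 JD JM] := ideal_exp_ideal I j.
by apply: (big_ind (ideal_exp I j)) => // i _; apply: JM; apply: bJ.
Qed.

Variable p : prime_idealr R.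

Lemma idvd_le j k x : (j <= k)%N -> idvd p k x -> idvd p j x.
Proof. by move=> /subnK <-; elim: (k - j)%N => // i IH /ideal_expS. Qed.

Lemma idvd0 j : idvd p j 0.
Proof. by case: (ideal_exp_ideal [set` p] j). Qed.

Lemma idvdMl j a x : idvd p j x -> idvd p j (a * x).
Proof. by case: (ideal_exp_ideal [set` p] j) => _ _; apply. Qed.

Lemma idvd1 x : idvd p 1 x <-> x \in p.
Proof.
split=> [[n [a [b [aI _ ->]]]]|px].
  by apply: rpred_sum => i _; rewrite mulrC idealMr //; apply: aI.
by exists 1%N, (fun=> x), (fun=> 1); split=> //; rewrite big_ord1 mulr1.
Qed.

End IdealPowers.

(** * Elements of K as fractions of algebraic integers *)

Section RingOfIntegersTheory.
Variable K : fieldExtType rat.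
Local Notation OK := (ring_of_integers K).

HB.instance Definition _ :=
  GRing.RMorphism.copy (@int_val K) (\val : OK -> K).

Lemma int_val0 : int_val (0 : OK) = 0.
Proof. exact: rmorph0. Qed.

Lemma int_val1 : int_val (1 : OK) = 1.
Proof. exact: rmorph1. Qed.

Lemma int_valB (a b : OK) : int_val (a - b) = int_val a - int_val b.
Proof. exact: rmorphB. Qed.

Lemma int_valM (a b : OK) : int_val (a * b) = int_val a * int_val b.
Proof. exact: rmorphM. Qed.

Lemma int_val_inj : injective (@int_val K).
Proof. exact: (@val_inj _ _ OK). Qed.

Lemma int_val_eq0 (a : OK) : (int_val a == 0) = (a == 0).
Proof. by rewrite -(inj_eq int_val_inj) rmorph0. Qed.

Lemma integral_eltP (x : K) :
  reflect (integralOver (intr : int -> K) x) (x \in @integral_elt K).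
Proof. exact: asboolP. Qed.

(** With a the leading coefficient and n + 1 the degree of P, a x is a root of the monic polynomial
    a^n P(X / a), whose lower coefficients P_i a^(n - i) are integral. *)
Lemma integral_lead_root (P : {poly K}) (x : K) :
  (forall i, P`_i \in @integral_elt K) -> root P x ->
  lead_coef P * x \in @integral_elt K.
Proof.
move=> Pint Px; have [->|P0] := eqVneq P 0; first by rewrite lead_coef0 mul0r rpred0.
have := root_size_gt1 P0 Px.
case eP: (size P) => [|[|n]] // _.
set a := lead_coef P.
pose Q := \poly_(i < n.+2) (if i == n.+1 then 1 else P`_i * a ^+ (n - i)).
have sQ : size Q = n.+2 by rewrite size_poly_eq // eqxx oner_neq0.
have Qmon : Q \is monic by rewrite monicE lead_coefE sQ coef_poly ltnSn eqxx.
apply/integral_eltP; apply: (@integral_root_monic _ _ intr _ Q) => //.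
  have -> : root Q (a * x) = (Q.[a * x] == 0) by [].
  have -> : Q.[a * x] = a ^+ n * P.[x].
    rewrite [Q.[_]]horner_poly horner_coef eP !big_ord_recr /= !mulrDr mulr_sumr.
    rewrite eqxx mul1r; congr (_ + _); last first.
      have -> : P`_n.+1 = a by rewrite /a lead_coefE eP.
      by rewrite exprMn exprSr mulrA.
    rewrite (ltn_eqF (ltnSn n)) subnn mulr1; congr (_ + _).
      apply: eq_bigr => i _; rewrite ltn_eqF ?(leq_trans (ltn_ord i)) //.
      have -> : (a ^+ n = a ^+ (n - i) * a ^+ i) by rewrite -exprD subnK // ltnW.
      by rewrite exprMn; ring.
    by rewrite exprMn; ring.
  by rewrite (rootP Px) mulr0.
apply/integral_poly => i; apply/integral_eltP; rewrite coef_poly.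
case: ifP => _; last exact: rpred0.
by case: ifP => _; rewrite ?rpred1 // rpredM ?rpredX ?Pint // lead_coefE.
Qed.

Lemma int_val_surj (x : K) : x \in @integral_elt K -> exists a : OK, int_val a = x.
Proof. by move=> ix; exists (RingOfIntegers ix). Qed.

Variable p : prime_idealr OK.

(* Horner's scheme: stripping the leading term [a X^n] down to [a x X^(n-1)]
   keeps the coefficients integral, and keeps them nonzero mod p as long as
   both a and a x lie in p. *)
Lemma root_fraction (P : {poly K}) (x : K) :
  (forall i, P`_i \in @integral_elt K) -> root P x ->
  (exists i, forall a : OK, int_val a = P`_i -> a \notin p) ->
  exists a b : OK, int_val a = int_val b * x /\ (a \notin p \/ b \notin p).
Proof.
have [n] := ubnP (size P); elim: n P => // n IH P sP Pint Px [i Pi].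
have P0 : P != 0.
  by apply/eqP=> P0; have := Pi 0; rewrite P0 coef0 rmorph0 rpred0 => /(_ erefl).
have sP1 := root_size_gt1 P0 Px.
have [b eb] := int_val_surj (Pint (size P).-1).
have [a ea] := int_val_surj (integral_lead_root Pint Px).
rewrite lead_coefE -eb in ea.
have [pa|na] := boolP (a \in p); last by exists a, b; split=> //; left.
have [pb|nb] := boolP (b \in p); last by exists a, b; split=> //; right.
have eS : size P = (size P).-2.+2 by case: (size P) sP1 => [|[|]].
set m := (size P).-2 in eS.
rewrite eS /= in eb.
(* Q = P - b X^m (X - x) keeps the root x and loses the leading term b X^(m+1), while a = b x is
   added to the coefficient of X^m. *)
pose Q := P - (int_val b)%:P * ('X^(m.+1) - x%:P * 'X^m).
have QE j : Q`_j = P`_j - int_val b * (j == m.+1)%:R + int_val a * (j == m)%:R.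
  by rewrite coefB coefCM coefB coefCM !coefXn ea; ring.
apply: (IH Q).
- suff : (size Q <= m.+1)%N by move: sP; rewrite eS; lia.
  apply/leq_sizeP => j; rewrite leq_eqVlt QE => /orP[/eqP<-|mj].
    by rewrite eqxx -eb gtn_eqF // mulr1 mulr0 subrr addr0.
  have -> : (j == m.+1) = false by lia.
  have -> : (j == m) = false by lia.
  rewrite !mulr0 subr0 addr0.
  by apply: nth_default; rewrite eS.
- have vI (z : OK) : int_val z \in @integral_elt K by case: z.
  by move=> j; rewrite QE rpredD ?rpredB ?rpredM ?rpred_nat ?vI ?Pint.
- have -> : root Q x = (Q.[x] == 0) by [].
  by rewrite !hornerE (rootP Px) exprS subrr mulr0 subr0.
(* The coefficients of P and Q differ by elements of p, as a and b lie in p; so the index i also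
   works for Q. *)
- exists i => c ec; apply: contra (Pi (c + b * (i == m.+1)%:R - a * (i == m)%:R) _).
    by move=> pc; rewrite rpredB ?rpredD // mulrC idealMr.
  by rewrite rmorphB rmorphD !rmorphM !rmorph_nat /= ec QE; ring.
Qed.

End RingOfIntegersTheory.

(** * Divisibility and residue field in the completion *)

Section CompletionTheory.
Variables (K : fieldExtType rat) (p : prime_idealr (ring_of_integers K)).
Variable Kp : padic_completion p.
Hypothesis p2 : (2 : ring_of_integers K) \in p.
Hypothesis f_p : has_inertial_degree p 2 1.
Local Notation OK := (ring_of_integers K).
Local Notation w := (@completion_val K p Kp).
Local Notation emb := (completion_embed Kp).
Local Notation V := (vball w).

(** x is a root of a primitive integer polynomial. One of its coefficients is odd, hence outside p,
    because p contains 2 but not 1; then [root_fraction] applies. *)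
Lemma fractionP (x : K) :
  exists a b : OK, int_val a = int_val b * x /\ (a \notin p \/ b \notin p).
Proof.
have [P Pmon Px] := alg_integral x.
have [q [c c0 eP]] := rat_poly_scale P.
have q0 : q != 0.
  apply: contraTneq Pmon => q0; rewrite eP q0 rmorph0 scaler0.
  by rewrite monicE lead_coef0 eq_sym oner_eq0.
have intr_alg (z : int) : in_alg K z%:~R = z%:~R by rewrite rmorph_int.
have intr_K0 (z : int) : (z%:~R == 0 :> K) = (z == 0).
  by rewrite -intr_alg fmorph_eq0 intr_eq0.
pose r := zprimitive q.
have rx : root (map_poly intr r) x.
  have : root (map_poly (intr : int -> K) q) x.
    move: Px; rewrite eP linearZ /= -map_poly_comp.
    rewrite (eq_map_poly (g := intr)) => [|z]; last exact: intr_alg.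
    by rewrite rootZ // scaler_eq0 oner_eq0 orbF invr_eq0 intr_eq0.
  by rewrite {1}[q]zpolyEprim linearZ /= rootZ // intr_K0 zcontents_eq0.
apply: (@root_fraction K p (map_poly intr r)) => //.
  by move=> i; rewrite coef_map rpred_int.
have : ~~ (2 %| zcontents r)%Z by rewrite zcontents_primitive q0.
rewrite dvdz_contents => /polyOverP nr.
have /existsNP[i /negP ni] : ~ forall i, (r`_i \in dvdz 2)%Z by [].
exists i => a; rewrite coef_map /= => ea.
have {}ea : a = (r`_i)%:~R by apply: int_val_inj; rewrite ea rmorph_int.
apply/negP; rewrite ea (divz_eq r`_i 2) intrD intrM => pa.
have : ((r`_i %% 2)%Z%:~R : OK) \in p.
  rewrite -[_%:~R](addKr (((r`_i %/ 2)%Z%:~R * 2%:~R) : OK)) addrC.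
  by rewrite rpredB // idealMr.
have -> : (r`_i %% 2)%Z = 1.
  move: ni; rewrite -[_ \in _]/((2 %| r`_i)%Z); lia.
by rewrite idealr1.
Qed.

Lemma emb_int_neq0 (a : OK) : (emb (int_val a) == 0) = (a == 0).
Proof. by rewrite fmorph_eq0 int_val_eq0. Qed.

Lemma val_exact i (a : OK) : idvd_exact p i a -> w (emb (int_val a)) = i.
Proof.
move=> ai; have a0 : a != 0.
  by apply: contra_notN ai.2 => /eqP->; exact: idvd0.
apply/completion_val_extends; first by rewrite int_val_eq0.
exists a, 1, i, 0%N; split=> //; last by rewrite subr0.
  by split=> // /idvd1; rewrite idealr1.
by rewrite int_val1 divr1.
Qed.

(* A value of the valuation at a is a difference of exact exponents of p,
   so a cannot lie in all the powers of p. *)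
Lemma exact_exists (a : OK) : a != 0 -> exists i, idvd_exact p i a.
Proof.
move=> a0; have ia0 : int_val a != 0.
  by rewrite int_val_eq0.
have [j nj] : exists j, ~ idvd p j a.
  have /(completion_val_extends Kp _ ia0)[b [c [i [j [bi cj e _]]]]] := erefl (w (emb (int_val a))).
  exists i.+1 => ai; apply: bi.2.
  have c0 : c != 0 by apply: contra_notN cj.2 => /eqP->; exact: idvd0.
  have -> : b = c * a.
    by apply: int_val_inj; rewrite int_valM e mulrC divfK // int_val_eq0.
  exact: idvdMl.
have exj : exists j, `[< ~ idvd p j a >] by exists j; apply/asboolP.
case: (ex_minnP exj) => [[|m]] /asboolP nm mle; first by case: nm.
exists m; split=> //; apply: contrapT => nm'.
by have := mle m; rewrite ltnn => /(_ (asboolT nm')).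
Qed.

(** For a nonzero, both sides say j <= i, where i is the exact exponent given by [exact_exists]. *)
Lemma idvdE j (a : OK) : idvd p j a <-> V j%:Z (emb (int_val a)).
Proof.
have [->|a0] := eqVneq a 0; first by rewrite int_val0 rmorph0; split=> _; [exact: vball0 | exact: idvd0].
have [i ai] := exact_exists a0.
rewrite vballE ?emb_int_neq0 // (val_exact ai); split=> [aj|ij].
  by rewrite lez_nat leqNgt; apply/negP => ij; apply: ai.2; apply: idvd_le aj.
by apply: idvd_le ai.1; rewrite -lez_nat.
Qed.

(** The quotient by p is in bijection with the two-element space F_2^1, and the classes of 0 and 1
    are distinct, so they are all of it. *)
Lemma int_residue (a : OK) : a \in p \/ a - 1 \in p.
Proof.
case: f_p => phi [psi phiK psiK].
pose pi (x : OK) : {ideal_quot p} := (\pi_({ideal_quot p}) x)%qT.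
have pi_eq x y : pi x = pi y -> x - y \in p.
  by move=> e; rewrite Quotient.idealrBE; apply/eqP.
have bit (v : 'rV['F_2]_1) : v = 0 \/ v = const_mx 1.
  have : v 0 0 = 0 \/ v 0 0 = 1.
    by case: (v 0 0) => [[|[|]] //= lt]; [left | right]; apply: val_inj.
  by case=> e; [left | right]; apply/rowP => i; rewrite ord1 e mxE.
have pi0 x : psi (pi x) = 0 -> x \in p.
  move=> e; rewrite -(subr0 x); apply: pi_eq.
  by rewrite -[LHS]psiK e raddf0 /pi raddf0.
case: (bit (psi (pi a))) => ea; first by left; apply: pi0.
case: (bit (psi (pi 1))) => e1; first by have := pi0 _ e1; rewrite idealr1.
by right; apply: pi_eq; rewrite -[LHS]psiK ea -e1 psiK.
Qed.

Lemma val_notin (a : OK) : a \notin p -> w (emb (int_val a)) = 0.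
Proof. by move=> na; apply: (@val_exact 0%N); split=> // /idvd1; apply/negP. Qed.

Lemma embed_residue (x : K) : V 0 (emb x) -> V 1 (emb x) \/ V 1 (emb x - 1).
Proof.
have w_val := completion_val_valuation Kp.
have [->|x0] := eqVneq x 0; first by rewrite rmorph0; left; exact: vball0.
rewrite vballE ?fmorph_eq0 // => wx.
have [a [b [e nab]]] := fractionP x.
have ee : emb (int_val a) = emb (int_val b) * emb x by rewrite e rmorphM.
(* If b were in p, a would not be, and the valuation of a = b x would be both 0 and at least 1. *)
have nb : b \notin p.
  case: nab => // na; apply/negP => pb.
  have b0 : b != 0.
    by apply: contraNneq na => b0; rewrite (_ : a = 0) ?rpred0 //;
       apply: int_val_inj; rewrite e b0 int_val0 mul0r.
  have /idvdE : idvd p 1 b by apply/idvd1.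
  rewrite vballE ?emb_int_neq0 // => wb; have := val_notin na.
  by rewrite ee valM ?fmorph_eq0 ?emb_int_neq0 //; move: wx wb;
     rewrite ?emb_int_neq0 //; set u := w _; set v := w _; lia.
have wb := val_notin nb.
have b0 : emb (int_val b) != 0.
  by rewrite emb_int_neq0; apply: contraNneq nb => ->; exact: rpred0.
(* Since b is a unit at p, x - c and b (x - c) = a - b c have the same valuation. As b is 1 modulo
   p, the residue of x is that of a. *)
have red (c : OK) : a - b * c \in p -> V 1 (emb x - emb (int_val c)).
  move=> /idvd1/idvdE.
  rewrite -[in X in _ -> X](vball_mul2r w_val _ _ b0) wb addr0.
  by congr (V _ _); rewrite int_valB int_valM !rmorphB !rmorphM e rmorphM; ring.
have [pa|pa] := int_residue a.
  by left; have := red 0; rewrite mulr0 subr0 int_val0 rmorph0 subr0; apply.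
have [pb|pb] := int_residue b; first by rewrite pb in nb.
right; have := red 1; rewrite mulr1 int_val1 rmorph1; apply.
have -> : a - b = (a - 1) - (b - 1) by ring.
exact: rpredB.
Qed.

(** By density y differs from an element of K by an element of the ball of radius 1, so residues are
    already found in K. *)
Lemma completion_residue (y : Kp) : V 0 y -> V 1 y \/ V 1 (y - 1).
Proof.
have w_val := completion_val_valuation Kp.
move=> vy; have [x /val_closeE xy] := completion_dense y 1.
have vx : V 0 (emb x) by rewrite (vball_congr w_val (vball_le xy _)).
have [v|v] := embed_residue vx; [left | right].
  by rewrite -(vball_congr w_val xy).
by apply: vball_trans v => //; rewrite vballBC.
Qed.

End CompletionTheory.

(** * The criteria as a finite check over all relations *)

Definition qdvd (c : quad) (k : nat) (l : seq N) : bool := quad_dvd k (quad_horner c l).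
Definition qexact (c : quad) (k : nat) (l : seq N) : bool :=
  qdvd c k l && ~~ qdvd c k.+1 l.

(* The polynomials in tau of the criteria, as coefficient lists, constant term
   first: crit5_3 is the one for s = 3 in case (5); a prime marks A_i + tau^8. *)
Definition tau4_add2 : seq N := [:: 2; 0; 0; 0; 1]%num.
Definition crit5_3 : seq N := [:: 4; 0; 0; 4; 0; 0; 2; 0; 1; 0; 0; 0; 1]%num.
Definition crit5_4 : seq N := [:: 4; 0; 0; 4; 0; 0; 2; 0; 1]%num.
Definition crit5_5 : seq N := [:: 4; 0; 4; 4; 0; 0; 0; 0; 1]%num.
Definition crit5_6 : seq N := [:: 4; 0; 4; 4; 0; 0; 0; 0; 1; 0; 0; 0; 1]%num.
Definition crit6_A1 : seq N := [:: 2; 4; 6; 4; 1]%num.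
Definition crit6_A2 : seq N := [:: 2; 4; 2; 0; 3; 0; 2; 0; 1]%num.
Definition crit6_A3 : seq N := [:: 2; 4; 2; 0; 1]%num.
Definition crit6_A4 : seq N := [:: 2; 4; 6; 4; 3; 0; 2; 0; 1]%num.
Definition crit6_A1' : seq N := [:: 2; 4; 6; 4; 1; 0; 0; 0; 1]%num.
Definition crit6_A2' : seq N := [:: 2; 4; 2; 0; 3; 0; 2; 0; 2]%num.
Definition crit6_A3' : seq N := [:: 2; 4; 2; 0; 1; 0; 0; 0; 1]%num.
Definition crit6_A4' : seq N := [:: 2; 4; 6; 4; 3; 0; 2; 0; 2]%num.
Definition crit7 : seq N := [:: 4; 0; 0; 4; 2; 0; 0; 0; 0; 0; 0; 0; 1]%num.
Definition crit8_B : seq N := [:: 2; 0; 0; 0; 1; 0; 0; 0; 1]%num.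
Definition crit8_1 : seq N := [:: 2; 0; 4; 0; 1; 0; 0; 0; 1]%num.
Definition crit8_2 : seq N := [:: 2; 0; 0; 4; 1; 0; 0; 0; 1; 0; 0; 0; 1]%num.
Definition crit8_3 : seq N := [:: 2; 0; 4; 4; 1; 0; 0; 0; 1; 0; 0; 0; 1]%num.
Definition crit8_4 : seq N := [:: 2; 0; 0; 0; 1; 0; 0; 0; 1; 0; 0; 0; 1]%num.
Definition crit8_5 : seq N := [:: 2; 0; 4; 0; 1; 0; 0; 0; 1; 0; 0; 0; 1]%num.
Definition crit8_6 : seq N := [:: 2; 0; 0; 4; 1; 0; 0; 0; 1]%num.
Definition crit8_7 : seq N := [:: 2; 0; 4; 4; 1; 0; 0; 0; 1]%num.
Definition crit10_1 : seq N := [:: 2; 0; 4; 4; 1; 0; 0; 0; 0; 0; 0; 0; 1]%num.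
Definition crit10_2 : seq N := [:: 2; 0; 4; 0; 1; 0; 0; 0; 0; 0; 0; 0; 1]%num.
Definition crit11 : seq N := [:: 2; 0; 0; 4; 1]%num.

(** The exponent 13 stands for mere divisibility: exactness there would require p^14, which
    quadruples cannot see. *)
Definition hypothesis_check (c : quad) (k : nat) : bool :=
  if (k < 13)%N then qexact c k tau4_add2 else qdvd c 13 tau4_add2.

(** The first conjunct bounds the level by 4, so in case (5) the tests for 5 and 6 succeed precisely
    when the divisibilities of [crit5_5] and [crit5_6] fail. The last conjunct says that exactly one
    exponent in 5, ..., 13 fits. *)
Definition relation_check (c : quad) : bool :=
  let n := quad_level c in
  let d := qdvd c 13 in
  [&& (0 < n <= 4)%N,
   qexact c 5 tau4_add2 ==>
     [&& (n == 3) == d crit5_3, (n == 4) == d crit5_4, (n == 5) == d crit5_5,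
         (n == 6) == d crit5_6 & [|| d crit5_3, d crit5_4, d crit5_5 | d crit5_6]],
   qexact c 6 tau4_add2 ==>
     let c1 := [|| d crit6_A1, d crit6_A2, d crit6_A3 | d crit6_A4] in
     let c2 := [|| qexact c 12 crit6_A1, qexact c 12 crit6_A2, qexact c 12 crit6_A3
                 | qexact c 12 crit6_A4]
            || [|| qdvd c 12 crit6_A1', qdvd c 12 crit6_A2', qdvd c 12 crit6_A3'
                 | qdvd c 12 crit6_A4'] in
     [&& (n == 1) == c1, (n == 2) == c2 & (n == 3) == ~~ c1 && ~~ c2],
   qexact c 7 tau4_add2 ==> ((n == 3) == d crit7) && ((n == 4) == ~~ d crit7),
   qexact c 8 tau4_add2 ==>
     let c2 := [|| d crit8_B, d crit8_1, d crit8_2 | d crit8_3] in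
     let c3 := [|| d crit8_4, d crit8_5, d crit8_6 | d crit8_7] in
     let c4 := qexact c 9 crit8_B in
     [&& (n == 2) == c2, (n == 3) == c3, (n == 4) == c4 & [|| c2, c3 | c4]],
   qexact c 9 tau4_add2 ==> (n == 4),
   qexact c 10 tau4_add2 ==>
     ((n == 2) == (d crit10_1 || d crit10_2)) && ((n == 3) == ~~ (d crit10_1 || d crit10_2)),
   qexact c 11 tau4_add2 ==> ((n == 2) == d crit11) && ((n == 3) == ~~ d crit11),
   qexact c 12 tau4_add2 ==> (n == 3),
   qdvd c 13 tau4_add2 ==> (n == 2)
 & has (fun k => hypothesis_check c k &&
     all (fun j => hypothesis_check c j ==> (k == j)) (iota 5 9)) (iota 5 9)].

Lemma all_relations_check : all relation_check quad_relations.
Proof. by vm_compute. Qed.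

Ltac poly_eq :=
  rewrite /hornerN /natN /N.to_nat /PosDef.Pos.to_nat /=; ring.

(** * Transfer of the check to the ideal p and the completion *)

Theorem theorem2p5 (K : fieldExtType rat)
    (p : prime_idealr (ring_of_integers K)) (Kp : padic_completion p)
    (p_dvd_2 : (2%:R : ring_of_integers K) \in p)
    (e_p : has_ramification_index p 2 4) (f_p : has_inertial_degree p 2 1)
    (tau : ring_of_integers K) (tau_p : idvd_exact p 1 tau) :
  let s := fourth_level Kp in
  (exists2 g : nat, (1 <= g <= 6)%N & s = Some g) /\
  (* (5) *)
  (idvd_exact p 5 (tau ^+ 4 + 2) ->
     let C3 := idvd p 13 (tau ^+ 12 + tau ^+ 8 + 2 * tau ^+ 6 + 4 * tau ^+ 3 + 4) in
     let C4 := idvd p 13 (tau ^+ 8 + 2 * tau ^+ 6 + 4 * tau ^+ 3 + 4) in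
     let C5 := idvd p 13 (tau ^+ 8 + 4 * tau ^+ 3 + 4 * tau ^+ 2 + 4) in
     let C6 := idvd p 13 (tau ^+ 12 + tau ^+ 8 + 4 * tau ^+ 3 + 4 * tau ^+ 2 + 4) in
     [/\ s = Some 3%N <-> C3, s = Some 4%N <-> C4,
         s = Some 5%N <-> C5, s = Some 6%N <-> C6 & [\/ C3, C4, C5 | C6]]) /\
  (* (6) *)
  (idvd_exact p 6 (tau ^+ 4 + 2) ->
     let A1 := 4 * tau ^+ 3 + 4 * tau ^+ 2 + 4 * tau
               + (tau ^+ 4 + 2 * tau ^+ 2 + 2) in
     let A2 := 4 * tau + (tau ^+ 4 + 1) * (tau ^+ 4 + 2 * tau ^+ 2 + 2) in
     let A3 := 4 * tau + (tau ^+ 4 + 2 * tau ^+ 2 + 2) in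
     let A4 := 4 * tau ^+ 3 + 4 * tau ^+ 2 + 4 * tau
               + (tau ^+ 4 + 1) * (tau ^+ 4 + 2 * tau ^+ 2 + 2) in
     let C1 := [\/ idvd p 13 A1, idvd p 13 A2, idvd p 13 A3 | idvd p 13 A4] in
     let C2 :=
       [\/ idvd_exact p 12 A1, idvd_exact p 12 A2, idvd_exact p 12 A3
         | idvd_exact p 12 A4] \/
       [\/ idvd p 12 (A1 + tau ^+ 8), idvd p 12 (A2 + tau ^+ 8),
           idvd p 12 (A3 + tau ^+ 8) | idvd p 12 (A4 + tau ^+ 8)] in
     [/\ s = Some 1%N <-> C1, s = Some 2%N <-> C2
       & s = Some 3%N <-> ~ C1 /\ ~ C2]) /\
  (* (7) *)
  (idvd_exact p 7 (tau ^+ 4 + 2) ->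
     let C3 := idvd p 13 (tau ^+ 12 + 4 * tau ^+ 3 + 2 * (tau ^+ 4 + 2)) in
     (s = Some 3%N <-> C3) /\ (s = Some 4%N <-> ~ C3)) /\
  (* (8) *)
  (idvd_exact p 8 (tau ^+ 4 + 2) ->
     let B := tau ^+ 8 + tau ^+ 4 + 2 in
     let C2 :=
       [\/ idvd p 13 B, idvd p 13 (4 * tau ^+ 2 + B),
           idvd p 13 (tau ^+ 12 + 4 * tau ^+ 3 + B)
         | idvd p 13 (tau ^+ 12 + 4 * tau ^+ 3 + 4 * tau ^+ 2 + B)] in
     let C3 :=
       [\/ idvd p 13 (tau ^+ 12 + B), idvd p 13 (tau ^+ 12 + 4 * tau ^+ 2 + B),
           idvd p 13 (4 * tau ^+ 3 + B)
         | idvd p 13 (4 * tau ^+ 3 + 4 * tau ^+ 2 + B)] in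
     let C4 := idvd_exact p 9 B in
     [/\ s = Some 2%N <-> C2, s = Some 3%N <-> C3, s = Some 4%N <-> C4
       & [\/ C2, C3 | C4]]) /\
  (* (9) *)
  (idvd_exact p 9 (tau ^+ 4 + 2) -> s = Some 4%N) /\
  (* (10) *)
  (idvd_exact p 10 (tau ^+ 4 + 2) ->
     let C2 :=
       idvd p 13 (tau ^+ 12 + 4 * tau ^+ 3 + 4 * tau ^+ 2 + tau ^+ 4 + 2) \/
       idvd p 13 (tau ^+ 12 + 4 * tau ^+ 2 + tau ^+ 4 + 2) in
     (s = Some 2%N <-> C2) /\ (s = Some 3%N <-> ~ C2)) /\
  (* (11) *)
  (idvd_exact p 11 (tau ^+ 4 + 2) ->
     let C2 := idvd p 13 (4 * tau ^+ 3 + tau ^+ 4 + 2) in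
     (s = Some 2%N <-> C2) /\ (s = Some 3%N <-> ~ C2)) /\
  (* (12) *)
  (idvd_exact p 12 (tau ^+ 4 + 2) -> s = Some 3%N) /\
  (* (13) *)
  (idvd p 13 (tau ^+ 4 + 2) -> s = Some 2%N) /\
  (* exactly one of the hypotheses (5)-(13) holds *)
  (exists! k : nat, (5 <= k <= 13)%N /\
     (if (k < 13)%N then idvd_exact p k (tau ^+ 4 + 2)
      else idvd p 13 (tau ^+ 4 + 2))).

Proof.
set t := completion_embed Kp (int_val tau).
have w_val := completion_val_valuation Kp.
have w_res := completion_residue (Kp := Kp) p_dvd_2 f_p.
have w_cpl := @completion_val_complete K p Kp.
have val_t : completion_val t = 1 by exact: (@val_exact _ _ Kp 1%N).
have nz (a : ring_of_integers K) i : idvd_exact p i a ->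
    completion_embed Kp (int_val a) != 0.
  move=> [_ na]; rewrite emb_int_neq0.
  by apply: contra_notN na => /eqP->; exact: idvd0.
have t0 : t != 0 by exact: nz tau_p.
have e2 : completion_embed Kp (int_val (2 : ring_of_integers K)) = 2.
  by rewrite !rmorph_nat.
have two0 : (2 : Kp) != 0 by rewrite -e2; apply: nz e_p.
have val2 : completion_val (2 : Kp) = 4 by rewrite -e2; exact: (val_exact Kp e_p).
(* Among the 256 relations, c is one satisfied by the image of tau modulo t^13; every claim is then
   read off the check of c. *)
have [c cR c_rel] := exists_relation w_val w_res t0 val_t two0 val2.
have := allP all_relations_check c cR.
(* Equality of propositions, rather than equivalence, allows rewriting inside the compound
   criteria. *)
have qdvdE k l a : (k <= 13)%N -> a = hornerN tau l ->
    idvd p k a = qdvd c k l :> Prop.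
  move=> k13 ->; apply/propext; rewrite (idvdE Kp).
  have -> : completion_embed Kp (int_val (hornerN tau l)) = hornerN t l.
    by rewrite !rmorph_hornerN.
  by rewrite (vball_hornerE w_val t0 val_t two0 val2 c_rel).
have qexactE k l a : (k < 13)%N -> a = hornerN tau l ->
    idvd_exact p k a = qexact c k l :> Prop.
  move=> k13 e; apply/propext; rewrite /idvd_exact.
  rewrite (qdvdE k l) ?(ltnW k13) // (qdvdE k.+1 l) //; split.
    by case=> h /negP h'; apply/andP.
  by case/andP=> h /negP.
move=> /and5P[/andP[n0 n4] k5 k6 k7 /and5P[k8 k9 k10 k11 /and3P[k12 k13 kex]]] s.
have levelE m : (s = Some m) = (quad_level c == m) :> Prop.
  apply/propext; rewrite /s (quad_levelP w_val w_res w_cpl t0 val_t two0 val2 c_rel n4).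
  by split=> [[->]|/eqP->].
have hypE k : (k <= 13)%N -> (if (k < 13)%N then idvd_exact p k (tau ^+ 4 + 2)
    else idvd p 13 (tau ^+ 4 + 2)) = hypothesis_check c k :> Prop.
  rewrite /hypothesis_check => k_le; case: ifP => [k_lt|_].
    by rewrite (qexactE k tau4_add2) //; poly_eq.
  by rewrite (qdvdE 13%N tau4_add2) //; poly_eq.
split.
  exists (quad_level c); last by rewrite levelE.
  by rewrite n0 (leq_trans n4).
split.
  rewrite (qexactE 5 tau4_add2) // => [h5|]; last by poly_eq.
  cbv zeta; rewrite !levelE (qdvdE 13%N crit5_3) //; last by poly_eq.
  rewrite (qdvdE 13%N crit5_4) //; last by poly_eq.
  rewrite (qdvdE 13%N crit5_5) //; last by poly_eq.
  rewrite (qdvdE 13%N crit5_6) //; last by poly_eq.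
  by move: k5; rewrite h5 => /and5P[/eqP-> /eqP-> /eqP-> /eqP-> /or4P].
split.
  rewrite (qexactE 6 tau4_add2) // => [h6|]; last by poly_eq.
  cbv zeta; rewrite !levelE (qdvdE 13%N crit6_A1) //; last by poly_eq.
  rewrite (qdvdE 13%N crit6_A2) //; last by poly_eq.
  rewrite (qdvdE 13%N crit6_A3) //; last by poly_eq.
  rewrite (qdvdE 13%N crit6_A4) //; last by poly_eq.
  rewrite (qexactE 12%N crit6_A1) //; last by poly_eq.
  rewrite (qexactE 12%N crit6_A2) //; last by poly_eq.
  rewrite (qexactE 12%N crit6_A3) //; last by poly_eq.
  rewrite (qexactE 12%N crit6_A4) //; last by poly_eq.
  rewrite (qdvdE 12%N crit6_A1') //; last by poly_eq.
  rewrite (qdvdE 12%N crit6_A2') //; last by poly_eq.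
  rewrite (qdvdE 12%N crit6_A3') //; last by poly_eq.
  rewrite (qdvdE 12%N crit6_A4') //; last by poly_eq.
  (* The disjunctions of booleans become single booleans, matching [c1] and [c2] in the check. *)
  rewrite !(propext (rwP or4P)) (propext (rwP orP)).
  move: k6; rewrite h6 => /and3P[/eqP-> /eqP-> /eqP->].
  by split=> //; rewrite !(propext (rwP negP)) (propext (rwP andP)).
split.
  rewrite (qexactE 7 tau4_add2) // => [h7|]; last by poly_eq.
  cbv zeta; rewrite !levelE (qdvdE 13%N crit7) //; last by poly_eq.
  move: k7; rewrite h7 => /andP[/eqP-> /eqP->].
  by rewrite (propext (rwP negP)).
split.
  rewrite (qexactE 8 tau4_add2) // => [h8|]; last by poly_eq.
  cbv zeta; rewrite !levelE (qdvdE 13%N crit8_B) //; last by poly_eq.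
  rewrite (qdvdE 13%N crit8_1) //; last by poly_eq.
  rewrite (qdvdE 13%N crit8_2) //; last by poly_eq.
  rewrite (qdvdE 13%N crit8_3) //; last by poly_eq.
  rewrite (qdvdE 13%N crit8_4) //; last by poly_eq.
  rewrite (qdvdE 13%N crit8_5) //; last by poly_eq.
  rewrite (qdvdE 13%N crit8_6) //; last by poly_eq.
  rewrite (qdvdE 13%N crit8_7) //; last by poly_eq.
  rewrite (qexactE 9%N crit8_B) //; last by poly_eq.
  rewrite !(propext (rwP or4P)).
  by move: k8; rewrite h8 => /and4P[/eqP-> /eqP-> /eqP-> /or3P].
split.
  rewrite (qexactE 9 tau4_add2) // => [h9|]; last by poly_eq.
  by move: k9; rewrite h9 levelE.
split.
  rewrite (qexactE 10 tau4_add2) // => [h10|]; last by poly_eq.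
  cbv zeta; rewrite !levelE (qdvdE 13%N crit10_1) //; last by poly_eq.
  rewrite (qdvdE 13%N crit10_2) //; last by poly_eq.
  rewrite (propext (rwP orP)) (propext (rwP negP)).
  by move: k10; rewrite h10 => /andP[/eqP-> /eqP->].
split.
  rewrite (qexactE 11 tau4_add2) // => [h11|]; last by poly_eq.
  cbv zeta; rewrite !levelE (qdvdE 13%N crit11) //; last by poly_eq.
  rewrite (propext (rwP negP)).
  by move: k11; rewrite h11 => /andP[/eqP-> /eqP->].
split.
  rewrite (qexactE 12 tau4_add2) // => [h12|]; last by poly_eq.
  by move: k12; rewrite h12 levelE.
split.
  rewrite (qdvdE 13 tau4_add2) // => [h13|]; last by poly_eq.
  by move: k13; rewrite h13 levelE.
(* [iota 5 9] enumerates 5, ..., 13; the inner [all] of the check gives uniqueness. *)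
case/hasP: kex => k; rewrite mem_iota => /andP[k5' k13'] /andP[hk /allP kuniq].
exists k; split=> [|j [/andP[j5 j13]]]; first by rewrite hypE // k5'.
rewrite hypE // => hj; have := kuniq j.
by rewrite mem_iota j5 ltnS j13 hj => /(_ isT) /eqP.
Qed.
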